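(* Writing $a_m:=a_m(21;2\to 2)$, for $n\ge 1$ we have $a_n=d_n+\sum_{i=1}^{n}d_{n-i}\,a_{i-1}$, where $d_m$ is the $m$-th derangement number.
   Context: Standard cycle form of $\sigma\in S_n$: product of disjoint cycles (fixed points included), each cycle starting with its largest element, cycles listed in increasing order of largest elements. The fundamental bijection $\theta:S_n\to S_n$ erases the parentheses of the standard cycle form to give a one-line permutation. For $\pi\in S_n$, $\hat\pi=\theta^{-1}(\pi)$. An arrow pattern $(\nu;H)$ of size $k$: a string $\nu=a_1\dots a_m$ of positive integers and a set $H$ of arrows $b\to c$, with all integers appearing forming $[k]$. $\pi\in S_n$ contains $(\nu;H)$ if there is $X=\{x_1<\dots<x_k\}\subseteq[n]$ with positions $t_1<\dots<t_m$ such that $\pi_{t_1}\cdots\pi_{t_m}=x_{a_1}\cdots x_{a_m}$ and $\hat\pi(x_b)=x_c$ for every arrow $b\to c\in H$; otherwise it avoids it. $a_n(\nu;H)$ = number of $\pi\in S_n$ avoiding $(\nu;H)$. $d_m$ = number of fixed-point-free permutations of $[m]$, with $d_0=1$; also $a_0=1$ (the empty permutation). *)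

(* Defs.v *)
From mathcomp Require Import all_boot fingroup perm.

Set Implicit Arguments.
Unset Strict Implicit.
Unset Printing Implicit Defensive.

(* The set [n] is represented by 'I_n, and S_n by 'S_n; the integer v of [n]
   is thus the ordinal of value v - 1. *)

Section FundamentalBijection.

Variable n : nat.
Implicit Types s pi : 'S_n.

(* The orbit of m lists the cycle of s through m as m, s m, s (s m), ...  One
   cycle is kept for each m that is the largest element of its own cycle, and
   enum 'I_n is increasing. *)
Definition std_cycle_form s : seq (seq 'I_n) :=
  [seq orbit s m | m : 'I_n <- enum 'I_n & all (fun j : 'I_n => j <= m) (orbit s m)].

Definition theta_word s : seq 'I_n := flatten (std_cycle_form s).

Lemma same_orbit s (x y z : 'I_n) :
  z \in orbit s x -> z \in orbit s y -> y \in orbit s x.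
Proof.
have sC := fconnect_sym (@perm_inj _ s).
rewrite -!fconnect_orbit => xz yz.
by apply: connect_trans xz _; rewrite sC.
Qed.

Lemma std_cycle_form_cover s x :
  exists2 m : 'I_n, all (fun j : 'I_n => j <= m) (orbit s m) & x \in orbit s m.
Proof.
have sC := fconnect_sym (@perm_inj _ s).
have xx : x \in orbit s x by exact: in_orbit.
pose m := [arg max_(i > x | i \in orbit s x) (i : nat)].
have [mx maxm] : m \in orbit s x /\ forall j, j \in orbit s x -> j <= m.
  by rewrite /m; case: arg_maxnP.
exists m; last by rewrite -fconnect_orbit sC fconnect_orbit.
apply/allP => j jm; apply: maxm; move: mx jm.
by rewrite -!fconnect_orbit; apply: connect_trans.
Qed.

Lemma mem_theta_word s x : x \in theta_word s.
Proof.
have [m maxm xm] := std_cycle_form_cover s x.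
apply/flattenP; exists (orbit s m) => //.
by apply: map_f; rewrite mem_filter maxm mem_enum.
Qed.

Lemma uniq_theta_word s : uniq (theta_word s).
Proof.
rewrite /theta_word /std_cycle_form.
have : uniq (enum 'I_n) by exact: enum_uniq.
elim: (enum 'I_n) => //= m e IH /andP[me /IH{IH} ue].
case: ifP => //= maxm; rewrite cat_uniq ue andbT (orbit_uniq s m) /=.
apply/hasPn => z /flattenP[_ /mapP[m' + ->] zm'].
rewrite mem_filter => /andP[maxm' m'e]; apply/negP => zm.
have m'm := same_orbit zm zm'; have mm' := same_orbit zm' zm.
have m_m' : m = m'.
  apply/val_inj/eqP; rewrite eqn_leq.
  by rewrite (allP maxm' _ mm') (allP maxm _ m'm).
by rewrite m_m' m'e in me.
Qed.

Lemma size_theta_word s : size (theta_word s) = n.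
Proof.
rewrite -(card_uniqP (uniq_theta_word s)) -[RHS]card_ord.
by apply: eq_card => x; rewrite mem_theta_word.
Qed.

Definition theta_fun s (i : 'I_n) : 'I_n := nth i (theta_word s) i.

Lemma theta_fun_inj s : injective (theta_fun s).
Proof.
move=> i j; rewrite /theta_fun (set_nth_default i j) ?size_theta_word //.
move/eqP; rewrite nth_uniq ?size_theta_word ?uniq_theta_word //.
by move/eqP/val_inj.
Qed.

Definition theta s : 'S_n := perm (@theta_fun_inj s).

Lemma theta_wordE s : theta_word s = [seq theta s i | i <- enum 'I_n].
Proof.
case: (posnP n) => [n0|n_gt0].
  have -> : enum 'I_n = [::] by apply: size0nil; rewrite size_enum_ord.
  by apply: size0nil; rewrite size_theta_word.
pose i0 := Ordinal n_gt0; apply: (@eq_from_nth _ i0) => [|i].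
  by rewrite size_map size_enum_ord size_theta_word.
rewrite size_theta_word => lt_in; rewrite (nth_map i0) ?size_enum_ord //.
rewrite (nth_ord_enum i0 (Ordinal lt_in)) permE /theta_fun /=.
by apply: set_nth_default; rewrite size_theta_word.
Qed.

(* The blocks of a standard cycle form can be read off its concatenation: a new
   block starts at each left-to-right maximum. *)
Definition block (b : seq 'I_n) : bool :=
  if b is x :: b' then all (fun y : 'I_n => y < x) b' else false.

Definition block_lt (b c : seq 'I_n) : bool :=
  if b is x :: _ then if c is y :: _ then x < y else false else false.

Lemma flatten_block_inj (L M : seq (seq 'I_n)) :
    all block L -> all block M -> pairwise block_lt L -> pairwise block_lt M ->
  flatten L = flatten M -> L = M.
Proof.
elim: L M => [|[|x b] L IH] [|[|y c] M] //=.
move=> /andP[bb bL] /andP[bc bM] /andP[xL pL] /andP[yM pM] [xy].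
subst y => /= E.
have find_cat (d : seq 'I_n) (K : seq (seq 'I_n)) :
    all (fun y : 'I_n => y < x) d -> all block K -> all (block_lt (x :: b)) K ->
    size d = find (fun y : 'I_n => x < y) (d ++ flatten K).
  move=> dx bK xK; rewrite find_cat; case: hasP => [[y yd xy]|_].
    by have := allP dx _ yd; rewrite ltnNge (ltnW xy).
  case: K bK xK => [|[|z e] K] //=; first by rewrite addn0.
  by move=> _ /andP[-> _]; rewrite addn0.
have sz : size b = size c.
  by rewrite (find_cat b L) // (find_cat c M) // E.
move/eqP: E; rewrite eqseq_cat // => /andP[/eqP <- /eqP E].
by rewrite (IH M).
Qed.

Lemma std_cycle_form_block s : all block (std_cycle_form s).
Proof.
apply/allP => _ /mapP[m + ->]; rewrite mem_filter => /andP[+ _].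
have := orbit_uniq s m; rewrite /orbit -orderSpred /=.
move=> /andP[mN _] /andP[_ /allP le_m]; apply/allP => j jm.
rewrite ltn_neqAle le_m // andbT; apply: contraNneq mN => jE.
by rewrite -[X in X \in _](val_inj jE : j = m).
Qed.

Lemma std_cycle_form_lt s : pairwise block_lt (std_cycle_form s).
Proof.
rewrite /std_cycle_form pairwise_map; apply: pairwise_filter.
have : pairwise ltn (map val (enum 'I_n)).
  by rewrite val_enum_ord -(sorted_pairwise ltn_trans) iota_ltn_sorted.
rewrite pairwise_map; apply: sub_pairwise => i j /= ij.
by rewrite /orbit -(orderSpred s i) -(orderSpred s j).
Qed.

Lemma theta_inj : injective theta.
Proof.
move=> s t E; have {E} : theta_word s = theta_word t by rewrite !theta_wordE E.
move/flatten_block_inj.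
move/(_ (std_cycle_form_block _) (std_cycle_form_block _)).
move/(_ (std_cycle_form_lt _) (std_cycle_form_lt _)) => E.
apply/permP => x; have [m maxm xm] := std_cycle_form_cover s x.
have : orbit s m \in std_cycle_form s.
  by apply: map_f; rewrite mem_filter maxm mem_enum.
rewrite {}E => /mapP[m' _ E].
rewrite -(nextE (cycle_orbit (@perm_inj _ s) m) xm).
by rewrite E (nextE (cycle_orbit (@perm_inj _ t) m')) // -E.
Qed.

Definition hat pi : 'S_n := invF theta_inj pi.

Lemma hatK : cancel hat theta.
Proof. exact: f_invF. Qed.

Lemma thetaK : cancel theta hat.
Proof. exact: invF_f. Qed.

End FundamentalBijection.

Record arrow_pattern (k : nat) := ArrowPattern {
  pat_word : seq 'I_k;
  pat_arrows : {set 'I_k * 'I_k};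
  pat_cover : forall a : 'I_k,
    a \in pat_word \/ exists2 e, e \in pat_arrows & (a == e.1) || (a == e.2)
}.

Definition ord_ltn n : rel 'I_n := [rel i j : 'I_n | i < j].

(* X is given as the increasing tuple x_1 < ... < x_k of its elements, and t is
   the increasing tuple of positions. *)
Definition contains n k (pi : 'S_n) (p : arrow_pattern k) : bool :=
  [exists x : k.-tuple 'I_n, exists t : (size (pat_word p)).-tuple 'I_n,
    [&& sorted (@ord_ltn n) x, sorted (@ord_ltn n) t,
        [seq pi i | i <- t] == [seq tnth x a | a <- pat_word p] &
        [forall e in pat_arrows p, hat pi (tnth x e.1) == tnth x e.2]]].

Definition num_avoiders k (p : arrow_pattern k) (n : nat) : nat :=
  #|[set pi : 'S_n | ~~ contains pi p]|.

Definition derangement_number (m : nat) : nat :=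
  #|[set s : 'S_m | [forall i, s i != i]]|.

Definition letter1 : 'I_2 := @Ordinal 2 0 isT.
Definition letter2 : 'I_2 := @Ordinal 2 1 isT.

Fact pattern_21_22_cover (a : 'I_2) :
  a \in [:: letter2; letter1] \/
  exists2 e, e \in [set (letter2, letter2)] & (a == e.1) || (a == e.2).
Proof. by left; rewrite !inE; case: a => [[|[|]]]. Qed.

(* The pattern (21; 2 -> 2). *)
Definition pattern_21_22 : arrow_pattern 2 :=
  ArrowPattern pattern_21_22_cover.

Lemma num_avoiders0 : num_avoiders pattern_21_22 0 = 1.
Proof.
rewrite /num_avoiders -[RHS](card_Sn 0) -cardsT; congr #|pred_of_set _|.
apply/setP => pi; rewrite !inE; apply/existsP => -[x _].
by case: (tnth x letter1).
Qed.

Lemma derangement_number0 : derangement_number 0 = 1.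
Proof.
rewrite /derangement_number -[RHS](card_Sn 0) -cardsT.
congr #|pred_of_set _|; apply/setP => s; rewrite !inE.
by apply/forallP => -[].
Qed.

(* Main.v *)
(* In the word of theta s, a fixed point v of s is a cycle of its own, and the
   letters to its right are those of the cycles with an element larger than v.
   Hence theta s avoids (21; 2 -> 2) iff s maps the letters below each of its
   fixed points to letters below that fixed point.  Splitting such an s at its
   largest fixed point i leaves a permutation of the same kind on the letters
   below i and a derangement on the letters above i. *)
Require Import Defs.
From mathcomp Require Import all_boot fingroup perm.

Set Implicit Arguments.
Unset Strict Implicit.
Unset Printing Implicit Defensive.

(** * Avoidance of the pattern in terms of cycles *)

Section ArrowPattern.

Variable n : nat.
Implicit Types (s pi : 'S_n) (v x : 'I_n).

Lemma index_theta_word s v :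
  index v (theta_word s) = ((theta s)^-1)%g v :> nat.
Proof.
rewrite theta_wordE -{1}(permKV (theta s) v) index_map ?index_enum_ord //.
exact: perm_inj.
Qed.

Lemma orbit_sym s x y : (x \in orbit s y) = (y \in orbit s x).
Proof. by rewrite -!fconnect_orbit (fconnect_sym (@perm_inj _ s)). Qed.

Lemma mem_orbit_fixed s v x : s v = v -> (x \in orbit s v) = (x == v).
Proof.
move=> sv; rewrite -fconnect_orbit.
apply/idP/eqP => [|->]; last exact: connect0.
by move/iter_findex <-; elim: findex => //= k ->.
Qed.

(** The cycle of [v] is the single block [[:: v]], and the maxima of the blocks increase along the
    word. So the letters after [v] are those whose cycle has its maximum above [v]. *)
Lemma index_fixed_ltn s v x : s v = v ->
  reflect (exists2 m, m \in orbit s x & v < m)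
          (index v (theta_word s) < index x (theta_word s)).
Proof.
move=> sv; set P := fun m : 'I_n => all (fun j : 'I_n => j <= m) (orbit s m).
have Pv : P v.
  by apply/allP => j; rewrite mem_orbit_fixed // => /eqP ->.
have : v \in filter P (enum 'I_n) by rewrite mem_filter Pv mem_enum.
have : pairwise (@ord_ltn n) (filter P (enum 'I_n)).
  apply: pairwise_filter; have : pairwise ltn (map val (enum 'I_n)).
    by rewrite val_enum_ord -(sorted_pairwise ltn_trans) iota_ltn_sorted.
  by rewrite pairwise_map.
have Pall : all P (filter P (enum 'I_n)) by exact: filter_all.
have memx := mem_theta_word s x; have := uniq_theta_word s; move: memx.
have -> : theta_word s = flatten (map (orbit s) (filter P (enum 'I_n))) by [].
move=> memx uw sP vP; case/splitPr: vP memx uw sP Pall => p1 p2.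
have ov : orbit s v = [:: v].
  apply: perm_small_eq => //; apply: uniq_perm; rewrite ?orbit_uniq // => y.
  by rewrite mem_orbit_fixed // inE.
rewrite map_cat flatten_cat /= ov /= pairwise_cat all_cat /=.
set w1 := flatten _; set w2 := flatten _.
rewrite mem_cat inE cat_uniq /= => memx /and3P[_ + /andP[vw2 _]].
rewrite negb_or => /andP[vw1 _].
case/and3P => /allrelP lt12 _ /andP[/allP lt2 _].
case/and3P => /allP P1 _ /allP P2.
rewrite !index_cat (negPf vw1) /= eqxx addn0.
have lt1 m : m \in p1 -> m < v by move=> ?; apply: lt12; rewrite // inE eqxx.
(* If [x] lies before [v], the maximum [m'] of its cycle is below [v] and bounds the whole orbit of
   [x]. *)
case: ifP => [xw1|xw1].
  rewrite ltnNge ltnW ?index_mem //=; constructor => -[m mx vm].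
  have /flattenP[_ /mapP[m' m'1 ->] xm'] := xw1.
  have /allP/(_ m) := P1 _ m'1; rewrite -fconnect_orbit.
  rewrite (connect_trans (y := x)) ?fconnect_orbit // => /(_ isT) mm'.
  by have := leq_ltn_trans mm' (lt1 _ m'1); rewrite ltnNge (ltnW vm).
case: eqP => [<-|vx].
  rewrite addn0 ltnn; constructor=> -[m].
  by rewrite mem_orbit_fixed // => /eqP ->; rewrite ltnn.
rewrite -[X in X < _]addn0 ltn_add2l /=; constructor.
move: memx; rewrite xw1 /= => /orP[/eqP xv|]; first by case: vx.
(* Here [x] lies after [v], and the witness is the maximum of its cycle. *)
case/flattenP => _ /mapP[m m2 ->] xm; exists m; last exact: lt2.
by rewrite orbit_sym.
Qed.

Definition fixed_split s : bool :=
  [forall v, (s v == v) ==> [forall x : 'I_n, (x < v) ==> (s x < v)]].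

Lemma fixed_splitP s :
  reflect (forall v x, s v = v -> x < v -> s x < v) (fixed_split s).
Proof.
apply: (iffP forallP) => [H v x sv xv|H v].
  by have := H v; rewrite sv eqxx => /forallP/(_ x)/implyP; apply.
by apply/implyP => /eqP sv; apply/forallP => x; apply/implyP; apply: H.
Qed.

(** The positions of an occurrence are the preimages of its letters under [pi], so only the two
    letters remain to be quantified. *)
Lemma contains_21_22P pi :
  reflect (exists v x, [/\ hat pi v = v, x < v & (pi^-1)%g v < (pi^-1)%g x])
          (contains pi pattern_21_22).
Proof.
apply: (iffP existsP) => [[x /existsP[t]]|[v [x [piv xv vx]]]].
  case/and4P => xs ts /eqP pit /forall_inP/(_ (letter2, letter2)).
  rewrite inE eqxx => /(_ isT)/eqP pix.
  exists (tnth x letter2), (tnth x letter1); split=> //.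
    case/tupleP: x xs {pit pix} => x1 x; case/tupleP: x => x2 x.
    by rewrite tuple0 /= !(tnth_nth x1) /= andbT.
  case/tupleP: t ts pit => t1 t; case/tupleP: t => t2 t.
  by rewrite tuple0 /= => /andP[ts _] [<- <-]; rewrite !permK.
exists [tuple x; v]; apply/existsP; exists [tuple (pi^-1)%g v; (pi^-1)%g x].
apply/and4P; split; rewrite /= ?andbT //.
  by rewrite !permKV.
by apply/forall_inP => e; rewrite inE => /eqP-> /=; apply/eqP.
Qed.

Lemma contains_theta s : contains (theta s) pattern_21_22 = ~~ fixed_split s.
Proof.
apply/contains_21_22P/idP => [[v [x []]]|].
  rewrite thetaK -!index_theta_word => sv xv /(index_fixed_ltn _ sv)[m mx vm].
  (* Iterating [s] from [x] would never leave the letters below [v], so the orbit could not reach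
     [m]. *)
  apply/negP => /fixed_splitP split_s; move: mx vm.
  rewrite -fconnect_orbit => /iter_findex <-; rewrite ltnNge => /negP; apply.
  apply: ltnW; elim: findex => //= k; exact: split_s.
rewrite negb_forall => /existsP[v]; rewrite negb_imply negb_forall.
case/andP=> /eqP sv /existsP[x]; rewrite negb_imply -leqNgt => /andP[xv vsx].
exists v, x; split; rewrite ?thetaK // -!index_theta_word.
apply/(index_fixed_ltn _ sv); exists (s x).
  by rewrite -fconnect_orbit fconnect1.
(* [s x] differs from [v], since the only preimage of [v] is [v] itself. *)
rewrite ltn_neqAle vsx andbT; apply: contraTneq xv => vE.
by rewrite (perm_inj (etrans sv (val_inj vE))) ltnn.
Qed.

End ArrowPattern.

Lemma num_avoiders_fixed_split n :
  num_avoiders pattern_21_22 n = #|[set s : 'S_n | fixed_split s]|.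
Proof.
rewrite -(card_imset _ (@theta_inj n)); congr #|pred_of_set _|.
apply/setP => pi; rewrite inE -{1}(hatK pi) contains_theta negbK.
by rewrite -{2}(hatK pi) mem_imset ?inE //; apply: theta_inj.
Qed.

(** * Direct sums of permutations *)

Section DirectSum.

Variables a b : nat.
Implicit Types (s : 'S_a) (t : 'S_b).

Definition sum_perm_fun s t (i : 'I_(a + b)) : 'I_(a + b) :=
  match split i with
  | inl j => lshift b (s j)
  | inr k => rshift a (t k)
  end.

Lemma sum_perm_fun_inj s t : injective (sum_perm_fun s t).
Proof.
move=> i j; rewrite /sum_perm_fun.
case: (split_ordP i) => i' ->; case: (split_ordP j) => j' -> /eqP.
- by rewrite eq_lshift => /eqP/perm_inj ->.
- by rewrite eq_lrshift.
- by rewrite eq_rlshift.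
- by rewrite eq_rshift => /eqP/perm_inj ->.
Qed.

Definition sum_perm s t : 'S_(a + b) := perm (@sum_perm_fun_inj s t).

Lemma sum_perml s t i : sum_perm s t (lshift b i) = lshift b (s i).
Proof. by rewrite permE /sum_perm_fun (unsplitK (inl i)). Qed.

Lemma sum_permr s t i : sum_perm s t (rshift a i) = rshift a (t i).
Proof. by rewrite permE /sum_perm_fun (unsplitK (inr i)). Qed.

Lemma sum_perm_inj s s' t t' :
  sum_perm s t = sum_perm s' t' -> s = s' /\ t = t'.
Proof.
move=> E; split; apply/permP => i.
  by apply: (@lshift_inj a b); rewrite -(sum_perml s t) E sum_perml.
by apply: (@rshift_inj a b); rewrite -(sum_permr s t) E sum_permr.
Qed.

(** An injection of the [a] lower letters into themselves is onto, so every lower value is already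
    taken and the upper letters must go to upper letters. *)
Lemma sum_perm_surj (r : 'S_(a + b)) :
  (forall i : 'I_(a + b), i < a -> r i < a) -> exists s t, r = sum_perm s t.
Proof.
move=> ra.
have rl i : {j | r (lshift b i) = lshift b j}.
  exists (Ordinal (ra (lshift b i) (ltn_ord i))); exact: val_inj.
have sinj : injective (fun i => sval (rl i)).
  move=> i j /= E; apply: (@lshift_inj a b); apply: (@perm_inj _ r).
  by rewrite (svalP (rl i)) (svalP (rl j)) E.
pose s := perm sinj.
have sE i : r (lshift b i) = lshift b (s i).
  by rewrite permE; apply: (svalP (rl i)).
have rr i : {j | r (rshift a i) = rshift a j}.
  case: (split_ordP (r (rshift a i))) => j E; last by exists j.
  have : r (rshift a i) = r (lshift b ((s^-1)%g j)) by rewrite sE permKV.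
  by move/perm_inj/eqP; rewrite eq_rlshift.
have tinj : injective (fun i => sval (rr i)).
  move=> i j /= E; apply: (@rshift_inj a b); apply: (@perm_inj _ r).
  by rewrite (svalP (rr i)) (svalP (rr j)) E.
exists s, (perm tinj); apply/permP => i; case: (split_ordP i) => j ->.
  by rewrite sum_perml.
by rewrite sum_permr permE; apply: (svalP (rr j)).
Qed.

End DirectSum.

(** * Counting by the largest fixed point *)

Definition largest_fixed n (s : 'S_n) (i : 'I_n) : bool :=
  (s i == i) && [forall j : 'I_n, (i < j) ==> (s j != j)].

(** A permutation either is a derangement or has a unique largest fixed point. Written as a sum of
    indicators, this can be inserted into a cardinality and summed in the other order. *)
Lemma sum_largest_fixed n (s : 'S_n) :
  [forall i, s i != i] + \sum_i largest_fixed s i = 1.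
Proof.
case: forallP => [nofix|/forallP]; last first.
  rewrite negb_forall => /existsP[i0]; rewrite negbK => si0.
  have [m sm maxm] :=
    @arg_maxnP _ i0 (fun i => s i == i) (fun i => i : nat) si0.
  rewrite (bigD1 m) //= big1 => [|i im]; rewrite ?addn0 /largest_fixed.
    rewrite sm /=; case: forallP => // -[] j; apply/implyP => mj.
    by apply: contraL mj => /maxm; rewrite -leqNgt.
  apply/eqP; rewrite eqb0; apply: contra im => /andP[/maxm im /forallP/(_ m)].
  rewrite sm implybF -leqNgt => mi.
  by apply/eqP/val_inj/eqP; rewrite eqn_leq mi andbT; exact: im.
by rewrite big1 // => i _; rewrite /largest_fixed (negPf (nofix i)).
Qed.

Section CountLargestFixed.

Variables a b : nat.

Definition glue (p : 'S_a * 'S_b) : 'S_(a + (1 + b)) :=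
  sum_perm p.1 (sum_perm 1%g p.2).

Lemma glue_inj : injective glue.
Proof.
by move=> [s t] [s' t'] /sum_perm_inj[/= -> /sum_perm_inj[_ /= ->]].
Qed.

(** The letter of the middle summand of [glue], of value [a], in the form on which [sum_permr] and
    [sum_perml] compute. *)
Let i := rshift a (lshift b (@ord0 0)).

(** [glue] maps the pairs (permutation with [fixed_split], derangement) bijectively onto the set
    counted on the left. *)
Lemma card_largest_fixed :
  #|[set s : 'S_(a + (1 + b)) | fixed_split s & largest_fixed s i]| =
  derangement_number b * num_avoiders pattern_21_22 a.
Proof.
rewrite num_avoiders_fixed_split mulnC -cardsX -(card_imset _ glue_inj).
have iE : i = a :> nat by rewrite /= addn0.
congr #|pred_of_set _|; apply/setP => r; rewrite !inE.
apply/andP/imsetP => [[/fixed_splitP r_split]|[[s t] + ->]].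
  case/andP=> /eqP ri /forallP r_gt.
  (* Since [i] is fixed and has value [a], [r] preserves the letters below [a]. *)
  have [s [t' rE]] : exists s t', r = sum_perm s t'.
    by apply: sum_perm_surj => j; have := r_split i j ri; rewrite iE.
  have t'0 : t' (lshift b ord0) = lshift b ord0.
    by apply: (@rshift_inj a); rewrite -(sum_permr s) -rE.
  (* The lowest letter of [t'] is fixed, so it splits off as a block of size 1. *)
  have [u [t t'E]] : exists u t, t' = sum_perm u t.
    apply: sum_perm_surj => j; rewrite ltnS leqn0 => /eqP j0.
    by rewrite (_ : j = lshift b ord0) ?t'0 //; apply: val_inj.
  have u1 : u = 1%g by apply/permP => j; rewrite [LHS]ord1 [RHS]ord1.
  exists (s, t); last by rewrite rE t'E u1.
  rewrite !inE /=; apply/andP; split.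
    apply/fixed_splitP => v x sv xv.
    have := r_split (lshift _ v) (lshift _ x).
    by rewrite rE !sum_perml sv; apply.
  apply/forallP => j; have := r_gt (rshift a (rshift 1 j)).
  rewrite /= ltn_add2l rE t'E !sum_permr /=.
  by apply: contra => /eqP->.
rewrite !inE /= => /andP[/fixed_splitP s_split /forallP t_der].
(* A fixed point above [i] would give one of the derangement [t]. *)
have fix_le j : glue (s, t) j = j -> j <= i.
  rewrite iE; case: (split_ordP j) => [j' -> _|k ->]; last first.
    case: (split_ordP k) => [j' ->|k' ->]; first by rewrite ord1 /= addn0.
    rewrite /glue !sum_permr => /rshift_inj/rshift_inj E.
    by have := t_der k'; rewrite E eqxx.
  exact: ltnW (ltn_ord j').
split.
  apply/fixed_splitP => v x.
  case: (split_ordP v) => v' -> gv xv.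
    have xa : x < a by apply: ltn_trans xv (ltn_ord v').
    move: gv xv; rewrite (_ : x = lshift _ (Ordinal xa)); last exact: val_inj.
    by rewrite /glue !sum_perml => /lshift_inj sv; apply: s_split.
  (* A fixed [v] outside the lower block has value [a], so [x] lies in the lower block, which [glue]
     preserves. *)
  have xa : x < a by have := leq_trans xv (fix_le _ gv); rewrite iE.
  rewrite (_ : x = lshift _ (Ordinal xa)); last exact: val_inj.
  by rewrite /glue sum_perml /= ltn_addr.
rewrite /largest_fixed /glue sum_permr sum_perml perm1 eqxx /=.
apply/forallP => j; apply/implyP; apply: contraTneq => /fix_le.
by rewrite -leqNgt.
Qed.

End CountLargestFixed.

Lemma sum_nat_of_bool (T : finType) (A : {set T}) (P : pred T) :
  \sum_(x in A) P x = #|[set x in A | P x]|.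
Proof. by rewrite -sum1dep_card big_mkcondr. Qed.

Theorem theorem4p2 (n : nat) (hn : 1 <= n) :
  num_avoiders pattern_21_22 n =
    derangement_number n +
    \sum_(1 <= i < n.+1)
      derangement_number (n - i) * num_avoiders pattern_21_22 (i - 1).
Proof.
rewrite num_avoiders_fixed_split -sum1_card.
rewrite (eq_bigr _ (fun s _ => esym (sum_largest_fixed s))) big_split /=.
congr (_ + _).
  (* Derangements satisfy [fixed_split] vacuously. *)
  rewrite sum_nat_of_bool; congr #|pred_of_set _|; apply/setP => s.
  rewrite !inE; apply: andb_idl => /forallP der.
  by apply/fixed_splitP => v x sv; have := der v; rewrite sv eqxx.
rewrite exchange_big big_add1 /= big_mkord; apply: eq_bigr => i _.
rewrite sum_nat_of_bool subn1 /=.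
(* After the index shift, the ordinal [i] has [i] letters below it and [n - i.+1] above it; these
   are the sizes of the outer blocks. *)
have nE : n = i + (1 + (n - i.+1)) by rewrite addnA addn1 subnKC.
move: (n - i.+1) nE => b nE; case: i nE => a /= lt_an nE; subst n.
rewrite -card_largest_fixed; congr #|pred_of_set _|; apply/setP => s.
rewrite !inE; congr (_ && largest_fixed _ _); apply: val_inj => /=.
by rewrite addn0.
Qed.
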